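(* Let $\mathbb{F}$ be any field and $A$ any $4\times 4$ matrix over $\mathbb{F}$. Then $$\det(A)=\Big(\sum_J\det(A_{\{1,2\},J})\Big)\Big(\sum_J\det(A_{\{3,4\},J})\Big)-\Big(\sum_J\det(A_{\{1,3\},J})\Big)\Big(\sum_J\det(A_{\{2,4\},J})\Big)+\Big(\sum_J\det(A_{\{1,4\},J})\Big)\Big(\sum_J\det(A_{\{2,3\},J})\Big),$$ where each sum ranges over all $2$-element subsets $J\subseteq\{1,2,3,4\}$.
   Context: For $I,J\subseteq[n]$, $A_{I,J}$ denotes the $|I|\times|J|$ submatrix of $A$ on the rows indexed by $I$ and the columns indexed by $J$ (rows and columns kept in increasing order). *)

(* Defs.v *)
From mathcomp Require Import all_boot all_order all_algebra.

Set Implicit Arguments.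
Unset Strict Implicit.
Unset Printing Implicit Defensive.

Import GRing.Theory.
Local Open Scope ring_scope.

(* enum_val lists a set of ordinals in increasing order, so the rows and      *)
(* columns of A_{I,J} keep their order.                                       *)
Definition set_submx (R : Type) (m n : nat) (A : 'M[R]_(m, n))
    (I : {set 'I_m}) (J : {set 'I_n}) : 'M[R]_(#|I|, #|J|) :=
  mxsub (fun i : 'I_#|I| => enum_val i) (fun j : 'I_#|J| => enum_val j) A.

(* \det needs a syntactically square type, hence the cast along #|J| = #|I|;  *)
(* the value 0 for #|J| != #|I| is a dummy.                                   *)
Definition minor (R : comNzRingType) (m n : nat) (A : 'M[R]_(m, n))
    (I : {set 'I_m}) (J : {set 'I_n}) : R :=
  match @eqP _ #|J| #|I| with
  | ReflectT eqJI => \det (castmx (erefl #|I|, eqJI) (set_submx A I J))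
  | ReflectF _ => 0
  end.

(* Main.v *)
(* For rows u, v, the sum over J of the 2 x 2 minors is the alternating form  *)
(* w(u, v) = sum_(j < k) (u_j v_k - u_k v_j).  The right-hand side is the     *)
(* 4-form (w /\ w) / 2 evaluated on the rows of A, so it is Pf(w) * det A     *)
(* with Pf(w) = 1 - 1 + 1 = 1.  In coordinates, once the sums over 2-subsets  *)
(* are sums over pairs j < k, this is a polynomial identity in the entries.   *)
Require Import Defs.
From mathcomp Require Import all_boot all_order all_algebra.
From mathcomp Require Import ring.

Set Implicit Arguments.
Unset Strict Implicit.
Unset Printing Implicit Defensive.

Import GRing.Theory.
Local Open Scope ring_scope.

(** The passage to coordinates rests on [sum_card2], as a 2-subset is the same as an increasing
    pair, and on [minor_set2]. Iterating [expand_det_nat_mx] turns the determinant into a polynomial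
    as well. *)

Lemma enum_set2_ord (n : nat) (i j : 'I_n) : (i < j)%N ->
  enum [set i; j] = [:: i; j].
Proof.
(* Two strictly increasing lists with the same members coincide. *)
move=> lt_ij; apply: (@irr_sorted_eq _ (relpre val ltn)).
- by move=> y x z; apply: ltn_trans.
- by move=> x; apply: ltnn.
- rewrite {1}/enum_mem -enumT; apply: sorted_filter.
    by move=> y x z; apply: ltn_trans.
  by rewrite -sorted_map val_enum_ord iota_ltn_sorted.
- by rewrite /= lt_ij.
- by move=> x; rewrite mem_enum !inE.
Qed.

Lemma card_set2_ord (n : nat) (i j : 'I_n) : (i < j)%N -> #|[set i; j]| = 2%N.
Proof. by move=> lt_ij; rewrite cardE enum_set2_ord. Qed.

(* Indexing entries by nat makes the Laplace expansion iterable by rewriting. *)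
Definition nat_mx (R : Type) (n : nat) (f : nat -> nat -> R) : 'M[R]_n :=
  \matrix_(i, j) f i j.

Lemma expand_det_nat_mx (R : comNzRingType) (n : nat) (f : nat -> nat -> R) :
  \det (nat_mx n.+1 f) =
  \sum_(k < n.+1)
    f 0%N k * ((-1) ^+ k * \det (nat_mx n (fun i j => f i.+1 (bump k j)))).
Proof.
rewrite (expand_det_row _ ord0); apply: eq_bigr => k _.
rewrite mxE /cofactor; congr (_ * (_ * \det _)).
by apply/matrixP => i j; rewrite !mxE.
Qed.

Lemma det_nat_mx2 (R : comNzRingType) (f : nat -> nat -> R) :
  \det (nat_mx 2 f) = f 0%N 0%N * f 1%N 1%N - f 0%N 1%N * f 1%N 0%N.
Proof.
rewrite !(expand_det_nat_mx, big_ord_recl, big_ord0) !det_mx00 /= /bump /=.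
by ring.
Qed.

Lemma minor_set2 (R : comNzRingType) (m n : nat) (A : 'M[R]_(m, n))
    (i1 i2 : 'I_m) (j1 j2 : 'I_n) : (i1 < i2)%N -> (j1 < j2)%N ->
  minor A [set i1; i2] [set j1; j2] = A i1 j1 * A i2 j2 - A i1 j2 * A i2 j1.
Proof.
move=> lt_i lt_j; rewrite /minor; case: eqP => [eqJI|]; last first.
  by rewrite !card_set2_ord.
pose f (k l : nat) := A (nth i1 [:: i1; i2] k) (nth j1 [:: j1; j2] l).
(* Writing the size 2 as [#|[set i1; i2]|] gives both matrices the same type. *)
rewrite -[RHS](det_nat_mx2 f) -(card_set2_ord lt_i).
congr (\det _); apply/matrixP => k l; rewrite castmxE !mxE /f /=.
by rewrite (enum_val_nth i1) (enum_val_nth j1) !enum_set2_ord // cast_ord_id.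
Qed.

Lemma sum_card2 (V : nmodType) (n : nat) (f : {set 'I_n} -> V) :
  \sum_(J : {set 'I_n} | #|J| == 2%N) f J =
  \sum_(j < n) \sum_(k < n | (j < k)%N) f [set j; k].
Proof.
rewrite pair_big_dep /=.
pose P := [set p : 'I_n * 'I_n | (p.1 < p.2)%N].
pose h (p : 'I_n * 'I_n) := [set p.1; p.2].
transitivity (\sum_(J in h @: P) f J).
  apply: eq_bigl => J; apply/idP/imsetP => [/cards2P[i [j [ne_ij ->]]]|[p]].
    case: (ltngtP i j) => [lt_ij|lt_ji|/val_inj eq_ij].
    - by exists (i, j); rewrite ?inE.
    - by exists (j, i); rewrite ?inE // /h setUC.
    - by rewrite eq_ij eqxx in ne_ij.
  by rewrite inE => lt_p ->; rewrite card_set2_ord.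
rewrite big_imset /=; first by apply: eq_bigl => p; rewrite inE.
(* Injectivity of [h]: the increasing enumeration of the set recovers the pair. *)
move=> [a b] [c d]; rewrite !inE /= => lt_ab lt_cd eq_h.
move: (enum_set2_ord lt_ab); rewrite [[set a; b]]eq_h enum_set2_ord //.
by case=> -> ->.
Qed.

(* 'I_4 is 0-based: inord k stands for the index k + 1. *)
Theorem theorem3p5 (F : fieldType) (A : 'M[F]_4) :
  \det A =
    (\sum_(J : {set 'I_4} | #|J| == 2%N) minor A [set inord 0; inord 1] J)
    * (\sum_(J : {set 'I_4} | #|J| == 2%N) minor A [set inord 2; inord 3] J)
  - (\sum_(J : {set 'I_4} | #|J| == 2%N) minor A [set inord 0; inord 2] J)
    * (\sum_(J : {set 'I_4} | #|J| == 2%N) minor A [set inord 1; inord 3] J)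
  + (\sum_(J : {set 'I_4} | #|J| == 2%N) minor A [set inord 0; inord 3] J)
    * (\sum_(J : {set 'I_4} | #|J| == 2%N) minor A [set inord 1; inord 2] J).
Proof.
pose f (i j : nat) := A (inord i) (inord j).
have detA : A = nat_mx 4 f.
  by apply/matrixP => i j; rewrite mxE /f !inord_val.
(* The test [j < k] is moved into the summand because [big_ord_recl] unrolls only unfiltered
   sums. *)
have sum_minor (i1 i2 : nat) : (i1 < i2 < 4)%N ->
    \sum_(J : {set 'I_4} | #|J| == 2%N) minor A [set inord i1; inord i2] J =
    \sum_(j < 4) \sum_(k < 4)
      if (j < k)%N then f i1 j * f i2 k - f i1 k * f i2 j else 0.
  case/andP=> lt_i lt_i4; rewrite sum_card2; apply: eq_bigr => j _.
  rewrite -big_mkcond; apply: eq_bigr => k lt_jk.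
  rewrite minor_set2 //; last first.
    by rewrite !inordK // (ltn_trans lt_i).
  by rewrite /f !inord_val.
rewrite !sum_minor // {1}detA.
rewrite !(expand_det_nat_mx, big_ord_recl, big_ord0) !det_mx00.
(* With tests and indices computed, both sides are polynomials in the same sixteen entries
   [f i j]. *)
rewrite /= /bump /= !(add1n, add0n) /=.
by ring.
Qed.
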